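(* Let $M,N,K\ge 1$ be integers, let $\mathbf H_1,\dots,\mathbf H_K\in\mathbb C^{N\times M}$, and let $W,\sigma^2,\eta,P_{\rm dyn},P_{\rm sta}>0$. For $K$-tuples of Hermitian positive semidefinite matrices $\mathbf Q_1,\dots,\mathbf Q_K\in\mathbb C^{N\times N}$ put $$g(\mathbf Q_1,\dots,\mathbf Q_K)=\frac{W\log\left|\mathbf I+\frac1{\sigma^2}\sum_{i=1}^K\mathbf H_i^H\mathbf Q_i\mathbf H_i\right|}{\frac1\eta\sum_{i=1}^K{\rm Tr}(\mathbf Q_i)+MP_{\rm dyn}+P_{\rm sta}} .$$ Then $g$ is quasiconcave on the convex set of all such $K$-tuples, and the optimal energy efficiency of the MIMO broadcasting channel satisfies $$\max_{P\ge 0}\frac{C_{\rm BC}(\mathbf H_1,\dots,\mathbf H_K,P)}{\frac P\eta+MP_{\rm dyn}+P_{\rm sta}}=\max_{\mathbf Q_1,\dots,\mathbf Q_K\succeq 0} g(\mathbf Q_1,\dots,\mathbf Q_K),$$ where $C_{\rm BC}$ is the broadcasting-channel sum capacity (defined in the context). Moreover, if $(\mathbf Q_1,\dots,\mathbf Q_K)$ attains the maximum on the right, then $P=\sum_{i=1}^K{\rm Tr}(\mathbf Q_i)$ attains the maximum on the left.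
   Context: $|\cdot|$ denotes the determinant, $\log$ is the base-2 logarithm, $^H$ is the conjugate transpose, and $\succeq 0$ means Hermitian positive semidefinite. For $P\ge 0$ the sum capacity of the MIMO broadcasting channel is $$C_{\rm BC}(\mathbf H_1,\dots,\mathbf H_K,P)=\max\ \sum_{i=1}^K W\log\frac{\left|\mathbf I+\frac1{\sigma^2}\mathbf H_i\left(\sum_{j=1}^{i}\mathbf\Sigma_j\right)\mathbf H_i^H\right|}{\left|\mathbf I+\frac1{\sigma^2}\mathbf H_i\left(\sum_{j=1}^{i-1}\mathbf\Sigma_j\right)\mathbf H_i^H\right|},$$ the maximum being over Hermitian positive semidefinite $\mathbf\Sigma_1,\dots,\mathbf\Sigma_K\in\mathbb C^{M\times M}$ with $\sum_{i=1}^K{\rm Tr}(\mathbf\Sigma_i)\le P$ (an empty sum is $\mathbf 0$). A real function $f$ on a convex set is quasiconcave if all superlevel sets $\{f\ge t\}$, $t\in\mathbb R$, are convex. *)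

(* Defs.v *)
From HB Require Import structures.
From mathcomp Require Import all_boot all_order all_algebra.
From mathcomp Require Import all_classical all_reals all_analysis.
From mathcomp Require Export complex.

Set Implicit Arguments.
Unset Strict Implicit.
Unset Printing Implicit Defensive.

Import Order.TTheory GRing.Theory Num.Theory.

Local Open Scope classical_set_scope.
Local Open Scope ring_scope.
Local Open Scope complex_scope.
Local Open Scope sesquilinear_scope.

Definition log2 (R : realType) (x : R) : R := ln x / ln 2.

(* In the partial order of R[i], 0 <= z says that z is real and nonnegative. *)
Definition psdmx (R : realType) (n : nat) (A : 'M[R[i]]_n) : Prop :=
  A \is hermsymmx /\ forall x : 'cV[R[i]]_n, 0 <= (x ^t* *m A *m x) 0 0.

Definition psd_tuples (R : realType) (K n : nat) : set ('I_K -> 'M[R[i]]_n) :=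
  [set A | forall i, psdmx (A i)].

(* Real-valued determinant and trace; they are only applied to Hermitian
   matrices, whose determinant and trace are real. *)
Definition rdet (R : realType) (n : nat) (A : 'M[R[i]]_n) : R :=
  complex.Re (\det A).
Definition rtr (R : realType) (n : nat) (A : 'M[R[i]]_n) : R :=
  complex.Re (\tr A).

Definition is_maximum (R : realType) (S : set R) (m : R) : Prop :=
  S m /\ ubound S m.

Definition attains_max (R : realType) (T : Type) (D : set T) (f : T -> R)
    (x : T) : Prop :=
  D x /\ forall y, D y -> f y <= f x.

(* The scalars of [convex_set] are the t : R[i] with 0 <= t <= 1, that is, the
   elements of the real unit interval: convexity is meant over the reals. *)
Definition quasiconcave_on (R : realType) (V : lmodType R[i]) (D : set V)
    (f : V -> R) : Prop :=
  forall t : R, convex_set [set x : V | D x /\ t <= f x].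

Section BroadcastChannel.
Context (R : realType) (M N K : nat).
Variables (H : 'I_K -> 'M[R[i]]_(N, M)) (W sigma2 : R).

Definition bc_noise_det (i : 'I_K) (S : 'M[R[i]]_M) : R :=
  rdet (1%:M + (sigma2^-1)%:C *: (H i *m S *m (H i) ^t*)).

Definition bc_sum_rate (S : 'I_K -> 'M[R[i]]_M) : R :=
  \sum_(i < K) W * log2 (bc_noise_det i (\sum_(j < K | (j <= i)%N) S j) /
                         bc_noise_det i (\sum_(j < K | (j < i)%N) S j)).

Definition bc_feasible (P : R) : set ('I_K -> 'M[R[i]]_M) :=
  [set S | psd_tuples S /\ \sum_(i < K) rtr (S i) <= P].

Definition bc_capacity (P : R) : R := sup (bc_sum_rate @` bc_feasible P).

Variables (eta Pdyn Psta : R).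

Definition total_power (P : R) : R := P / eta + M%:R * Pdyn + Psta.

Definition bc_energy_efficiency (P : R) : R := bc_capacity P / total_power P.

Definition mac_energy_efficiency (Q : 'I_K -> 'M[R[i]]_N) : R :=
  W * log2 (rdet (1%:M + (sigma2^-1)%:C *:
                    \sum_(i < K) (H i) ^t* *m Q i *m H i)) /
  total_power (\sum_(i < K) rtr (Q i)).

End BroadcastChannel.

(* Main.v *)
Require Import Defs.
From mathcomp Require Import all_boot all_order all_algebra.
From mathcomp Require Import all_classical all_reals all_analysis.
From mathcomp Require Import ring lra.

Set Implicit Arguments.
Unset Strict Implicit.
Unset Printing Implicit Defensive.

Import Order.TTheory GRing.Theory Num.Theory.
Import numFieldNormedType.Exports.

Local Open Scope classical_set_scope.
Local Open Scope ring_scope.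
Local Open Scope sesquilinear_scope.

(** The capacity of the broadcasting channel equals that of the dual multiple
    access channel with the same total power. Users are treated one at a time:
    given the interference [A_i] seen by user [i] in the broadcasting channel
    and [B_i] in the dual channel (decoded in the opposite order), polar
    decomposition of [A_i^{-1/2} H_i B_i^{-1/2}] turns [Q_i] into [S_i] with the
    same rate and [tr (B_i S_i) <= tr (A_i Q_i)], and conversely. Summed over
    [i], the interference powers on the two sides cancel, so the total power
    does not increase, while the rates in the dual channel telescope to a single
    log-determinant.

    The tangent inequality [ln |Y| <= ln |X| + tr (X^{-1} Y) - n] makes the rate
    concave, hence [g] quasiconcave (its denominator being affine and positive).
    With [X = k I] it also shows that [g] tends to [0] as the power grows, so the
    maximum is attained on a compact set. *)

(** * Conjugate transposes *)

Section ConjTranspose.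
Context (C : numClosedFieldType).

Lemma ctrmxM m n p (A : 'M[C]_(m, n)) (B : 'M[C]_(n, p)) :
  (A *m B) ^t* = B ^t* *m A ^t*.
Proof. by rewrite trmx_mul map_mxM. Qed.

Lemma ctrmxD m n (A B : 'M[C]_(m, n)) : (A + B) ^t* = A ^t* + B ^t*.
Proof. by rewrite linearD /= map_mxD. Qed.

Lemma ctrmxZ m n (c : C) (A : 'M[C]_(m, n)) : (c *: A) ^t* = c^* *: A ^t*.
Proof. by rewrite linearZ /= map_mxZ. Qed.

Lemma ctrmx1 n : (1%:M : 'M[C]_n) ^t* = 1%:M.
Proof. by rewrite trmx1 map_mx1. Qed.

Lemma ctrmx_inv n (A : 'M[C]_n) : (invmx A) ^t* = invmx (A ^t*).
Proof. by rewrite trmx_inv map_invmx. Qed.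

Lemma ctrmx_unit n (A : 'M[C]_n) : (A ^t* \in unitmx) = (A \in unitmx).
Proof. by rewrite map_unitmx unitmx_tr. Qed.

Lemma det_ctrmx n (A : 'M[C]_n) : \det (A ^t*) = (\det A)^*.
Proof. by rewrite det_map_mx det_tr. Qed.

Lemma ctrmx_diag_real n (d : 'rV[C]_n) : (forall i, d 0 i \is Num.real) ->
  (diag_mx d) ^t* = diag_mx d.
Proof.
move=> dr; rewrite tr_diag_mx map_diag_mx; congr diag_mx.
by apply/rowP => i; rewrite mxE; apply/CrealP.
Qed.

Lemma hermsymP n (A : 'M[C]_n) : reflect (A ^t* = A) (A \is hermsymmx).
Proof.
by apply: (iffP (is_hermitianmxP _ _ _)); rewrite expr0 scale1r => /esym.
Qed.

(** Sylvester's identity: one block matrix is factored in two ways into block-triangular matrices,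
    whose determinants are immediate. *)
Lemma det_1DC m n (A : 'M[C]_(m, n)) (B : 'M[C]_(n, m)) :
  \det (1%:M + A *m B) = \det (1%:M + B *m A).
Proof.
have E1 : block_mx 1%:M (- A) B 1%:M =
   block_mx 1%:M 0 B 1%:M *m block_mx 1%:M (- A) 0 (1%:M + B *m A).
  by rewrite mulmx_block !mul1mx !mulmx0 !mul0mx !mulmx1 !addr0 ?mulmxN ?add0r
             (addrC 1%:M (B *m A)) addKr.
have E2 : block_mx 1%:M (- A) B 1%:M =
   block_mx (1%:M + A *m B) (- A) 0 1%:M *m block_mx 1%:M 0 B 1%:M.
  by rewrite mulmx_block !mul1mx !mulmx0 !mul0mx !mulmx1 ?mulNmx !add0r addrK.
have := congr1 determinant E1; rewrite {1}E2 !det_mulmx.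
by rewrite !det_lblock !det_ublock !det1 !mulr1 !mul1r.
Qed.

End ConjTranspose.

(** * Semidefinite and definite matrices, log-determinants, one-user duality *)

Section Psd.
Local Open Scope complex_scope.
Context (R : realType).
Local Notation C := R[i].

Lemma psdmx0 n : psdmx (0 : 'M[C]_n).
Proof.
split; first by apply/hermsymP; rewrite trmx0 map_mx0.
by move=> x; rewrite mulmx0 mul0mx mxE.
Qed.

Lemma psdmxD n (A B : 'M[C]_n) : psdmx A -> psdmx B -> psdmx (A + B).
Proof.
move=> [/hermsymP hA pA] [/hermsymP hB pB]; split.
  by apply/hermsymP; rewrite ctrmxD hA hB.
by move=> x; rewrite mulmxDr mulmxDl mxE addr_ge0.
Qed.

Lemma psdmxZ n (c : C) (A : 'M[C]_n) : 0 <= c -> psdmx A -> psdmx (c *: A).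
Proof.
move=> c0 [/hermsymP hA pA]; split.
  by apply/hermsymP; rewrite ctrmxZ hA conj_Creal// ger0_real.
by move=> x; rewrite -scalemxAr -scalemxAl mxE mulr_ge0.
Qed.

Lemma psdmx_sum (I : finType) (P : pred I) n (A : I -> 'M[C]_n) :
  (forall i, P i -> psdmx (A i)) -> psdmx (\sum_(i | P i) A i).
Proof.
move=> pA; elim/big_ind : _ => //; [exact: psdmx0 | exact: psdmxD].
Qed.

Lemma psdmx_congr m n (A : 'M[C]_n) (B : 'M[C]_(n, m)) :
  psdmx A -> psdmx (B ^t* *m A *m B).
Proof.
move=> [/hermsymP hA pA]; split.
  by apply/hermsymP; rewrite !ctrmxM trmxCK hA mulmxA.
by move=> x; have := pA (B *m x); rewrite ctrmxM !mulmxA.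
Qed.

Lemma psdmx_congrC m n (A : 'M[C]_n) (B : 'M[C]_(m, n)) :
  psdmx A -> psdmx (B *m A *m B ^t*).
Proof. by move=> /(@psdmx_congr _ _ _ (B ^t*)); rewrite trmxCK. Qed.

Lemma psdmx_gram m n (B : 'M[C]_(m, n)) : psdmx (B *m B ^t*).
Proof.
split; first by apply/hermsymP; rewrite ctrmxM trmxCK.
move=> x; have -> : x ^t* *m (B *m B ^t*) *m x = (B ^t* *m x) ^t* *m (B ^t* *m x).
  by rewrite ctrmxM trmxCK !mulmxA.
rewrite mxE sumr_ge0// => i _; rewrite !mxE.
by rewrite mulrC -normCK exprn_ge0.
Qed.

Lemma psdmx_diag_ge0 n (A : 'M[C]_n) i : psdmx A -> 0 <= A i i.
Proof.
move=> [_ /(_ (delta_mx i 0))]; rewrite trmx_delta map_delta_mx.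
by rewrite -rowE -colE !mxE.
Qed.

(** The eigenvalues are diagonal entries of [V A V^H], hence nonnegative. *)
Lemma psdmx_spectral n (A : 'M[C]_n) : psdmx A ->
  exists V : 'M[C]_n, exists2 d : 'rV[C]_n, forall i, 0 <= d 0 i &
    [/\ V *m V ^t* = 1%:M, V ^t* *m V = 1%:M & A = V ^t* *m diag_mx d *m V].
Proof.
move=> pA; have [hA _] := pA.
have := hermitian_normalmx hA => /orthomx_spectralP.
set V := spectralmx A; set d := spectral_diag A => E.
have uV : V \is unitarymx by exact: spectral_unitarymx.
have VV : V *m V ^t* = 1%:M by apply/unitarymxP.
have VV' : V ^t* *m V = 1%:M by exact: mulmx1C.
rewrite (invmx_unitary uV) in E.
exists V, d; last by split.
move=> i; suff -> : d 0 i = (V *m A *m V ^t*) i i.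
  exact/psdmx_diag_ge0/psdmx_congrC.
rewrite E !mulmxA VV mul1mx -mulmxA VV mulmx1.
by rewrite mxE eqxx mulr1n.
Qed.

Lemma psdmx_trM_ge0 n (A B : 'M[C]_n) : psdmx A -> psdmx B -> 0 <= \tr (A *m B).
Proof.
move=> /psdmx_spectral[V [d d0 [_ _ ->]]] pB.
have -> : \tr (V ^t* *m diag_mx d *m V *m B) =
          \tr (diag_mx d *m (V *m B *m V ^t*)).
  by rewrite -!mulmxA mxtrace_mulC !mulmxA.
rewrite /mxtrace sumr_ge0// => i _; rewrite mul_diag_mx mxE mulr_ge0//.
exact/psdmx_diag_ge0/psdmx_congrC.
Qed.

Lemma psdmx_tr_ge0 n (A : 'M[C]_n) : psdmx A -> 0 <= \tr A.
Proof. by move=> pA; rewrite sumr_ge0// => i _; exact: psdmx_diag_ge0. Qed.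

(** Positive definiteness is encoded by an invertible factor, because [L] is what whitens the noise
    in [single_user]. *)
Definition pdmx n (A : 'M[C]_n) : Prop :=
  exists2 L : 'M[C]_n, L \in unitmx & A = L *m L ^t*.

Lemma pdmx1D n (A : 'M[C]_n) : psdmx A -> pdmx (1%:M + A).
Proof.
move=> /psdmx_spectral[V [d d0 [VV VV' ->]]].
(* The eigenvalues [1 + d_i] are positive, so their square roots give an invertible factor. *)
pose e := \row_i sqrtC (1 + d 0 i).
have e0 i : 0 <= e 0 i by rewrite mxE sqrtC_ge0 addr_ge0.
have uV : V \in unitmx by have [] := mulmx1_unit VV.
have ue : diag_mx e \in unitmx.
  rewrite unitmxE det_diag unitfE prodf_seq_neq0; apply/allP => i _ /=.
  by rewrite mxE sqrtC_eq0 gt_eqF// ltr_wpDr.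
exists (V ^t* *m diag_mx e); first by rewrite unitmx_mul ctrmx_unit uV.
rewrite ctrmxM trmxCK ctrmx_diag_real; last by move=> i; rewrite ger0_real.
rewrite [RHS]mulmxA -[in RHS](mulmxA (V ^t*)) mulmx_diag.
rewrite -{1}VV' -{1}(mulmx1 (V ^t*)) -mulmxDl -mulmxDr -diag_const_mx -raddfD.
congr (_ *m diag_mx _ *m _).
by apply/rowP => i; rewrite !mxE -expr2 sqrtCK.
Qed.

Lemma pdmx_unit n (A : 'M[C]_n) : pdmx A -> A \in unitmx.
Proof. by move=> [L uL ->]; rewrite unitmx_mul ctrmx_unit uL. Qed.

Lemma pdmx_psd n (A : 'M[C]_n) : pdmx A -> psdmx A.
Proof. by move=> [L uL ->]; exact: psdmx_gram. Qed.

Lemma pdmx_congr n (A B : 'M[C]_n) : B \in unitmx -> pdmx A ->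
  pdmx (B *m A *m B ^t*).
Proof.
move=> uB [L uL ->]; exists (B *m L); first by rewrite unitmx_mul uB.
by rewrite ctrmxM !mulmxA.
Qed.

Lemma pdmx_det_gt0 n (A : 'M[C]_n) : pdmx A -> 0 < \det A.
Proof.
move=> [L uL ->]; rewrite det_mulmx det_ctrmx -normCK exprn_gt0// normr_gt0.
by rewrite -unitfE -unitmxE.
Qed.

Lemma RRe_ge0 (z : C) : 0 <= z -> z = (complex.Re z)%:C.
Proof. by move=> /ger0_real /RRe_real. Qed.

Lemma le_Re (x y : C) : x <= y -> complex.Re x <= complex.Re y.
Proof. by rewrite lecE => /andP[]. Qed.

Lemma lt_Re (x y : C) : x < y -> complex.Re x < complex.Re y.
Proof. by rewrite ltcE => /andP[]. Qed.

Lemma pdmx_rdet_gt0 n (A : 'M[C]_n) : pdmx A -> 0 < rdet A.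
Proof. by move=> /pdmx_det_gt0 /lt_Re. Qed.

Lemma pdmx_detE n (A : 'M[C]_n) : pdmx A -> \det A = (rdet A)%:C.
Proof. by move=> /pdmx_det_gt0 /ltW /RRe_ge0. Qed.

(** The inequality [ln r <= r - 1], summed over the eigenvalues. *)
Lemma ln_det_le_tr n (A : 'M[C]_n) : pdmx A -> ln (rdet A) <= rtr A - n%:R.
Proof.
move=> pA; have := psdmx_spectral (pdmx_psd pA).
move=> [V [d d0 [VV VV' AE]]].
pose r i := complex.Re (d 0 i).
have rE i : d 0 i = (r i)%:C by exact: RRe_ge0.
have dA : \det A = \det (diag_mx d).
  rewrite AE !det_mulmx mulrAC -det_mulmx VV' det1 mul1r //.
have dAr : rdet A = \prod_i r i.
  rewrite /rdet dA det_diag (eq_bigr _ (fun i _ => rE i)).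
  by rewrite -(rmorph_prod (real_complex R)).
have trA : rtr A = \sum_i r i.
  rewrite /rtr AE -mulmxA mxtrace_mulC -mulmxA VV mulmx1 mxtrace_diag.
  by rewrite (eq_bigr _ (fun i _ => rE i)) -(rmorph_sum (real_complex R)).
have r0 i : 0 < r i.
  have : 0 <= r i by have := le_Re (d0 i).
  rewrite le_eqVlt => /predU1P[ri|//].
  have := pdmx_rdet_gt0 pA; rewrite dAr (bigD1 i)//= -ri mul0r ltxx //.
suff -> : ln (rdet A) = \sum_i ln (r i).
  have -> : n%:R = \sum_(i < n) 1 :> R by rewrite sumr_const card_ord.
  rewrite trA -sumrB; apply: ler_sum => i _.
  by rewrite -{1}(subrK 1 (r i)) addrC le_ln1Dx// ltrBrDl addrN.
(* Positivity of the partial products is carried through the induction because [lnM] requires it. *)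
rewrite dAr; suff [] : ln (\prod_i r i) = \sum_i ln (r i) /\ 0 < \prod_i r i by [].
elim/big_rec2 : _ => [|i x y _ [<- x0]]; first by rewrite ln1.
by rewrite lnM ?posrE// mulr_gt0.
Qed.

(** With [X = L L^H], this is [ln_det_le_tr] for [L^{-1} Y L^{-H}], whose determinant is [|Y| / |X|]
    and whose trace is that of [X^{-1} Y]. *)
Lemma ln_det_tangent n (X Y : 'M[C]_n) : pdmx X -> pdmx Y ->
  ln (rdet Y) <= ln (rdet X) + rtr (invmx X *m Y) - n%:R.
Proof.
move=> pX pY; have [L uL XE] := pX.
have uX := pdmx_unit pX.
have pZ : pdmx (invmx L *m Y *m (invmx L) ^t*).
  by apply: pdmx_congr => //; rewrite unitmx_inv.
have := ln_det_le_tr pZ.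
have -> : rtr (invmx L *m Y *m (invmx L) ^t*) = rtr (invmx X *m Y).
  rewrite /rtr -mulmxA mxtrace_mulC XE ctrmx_inv.
  have -> : invmx (L *m L ^t*) = invmx (L ^t*) *m invmx L.
    have uL' : L ^t* \in unitmx by rewrite ctrmx_unit.
    apply: (can_inj (mulKmx uX)); rewrite {1 2}XE mulmxV -?XE// XE.
    by rewrite mulmxA mulmxK// mulmxV.
  by rewrite -mulmxA -mulmxA mxtrace_mulC -!mulmxA mxtrace_mulC -!mulmxA.
suff -> : rdet (invmx L *m Y *m (invmx L) ^t*) = rdet Y / rdet X.
  rewrite ln_div ?posrE ?pdmx_rdet_gt0// => h; rewrite -addrA -lerBlDl//.
apply: complexI; rewrite rmorphM fmorphV /= -!pdmx_detE//.
rewrite XE !det_mulmx !det_ctrmx det_inv invfM fmorphV.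
by rewrite mulrAC [RHS]mulrC -mulrA.
Qed.

(* [S = U Q U^H], with [U] the partial isometry of the polar decomposition of
   [G^H]: then [G S G^H = T Q T] for [T = (G G^H)^{1/2}], and [T^2 = G G^H]. *)
Lemma flip_channel m n (G : 'M[C]_(n, m)) (Q : 'M[C]_n) : psdmx Q ->
  exists S : 'M[C]_m, [/\ psdmx S, \tr S <= \tr Q &
    \det (1%:M + G *m S *m G ^t*) = \det (1%:M + G ^t* *m Q *m G)].
Proof.
move=> pQ.
have [V [d d0 [VV VV' GE]]] := psdmx_spectral (psdmx_gram G).
pose e := \row_i sqrtC (d 0 i).
(* Since [0^-1 = 0], the matrix [T'] built from [f] is the pseudo-inverse of [T]; zero eigenvalues
   are therefore treated apart below. *)
pose f := \row_i (sqrtC (d 0 i))^-1.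
have fr i : f 0 i \is Num.real by rewrite mxE ger0_real// invr_ge0 sqrtC_ge0.
pose T := V ^t* *m diag_mx e *m V.
pose T' := V ^t* *m diag_mx f *m V.
have hT' : T' ^t* = T'.
  by rewrite /T' !ctrmxM trmxCK (ctrmx_diag_real fr) mulmxA.
have VDV (a b : 'rV[C]_n) : (V ^t* *m diag_mx a *m V) *m (V ^t* *m diag_mx b *m V) =
    V ^t* *m diag_mx (\row_i (a 0 i * b 0 i)) *m V.
  rewrite !mulmxA -(mulmxA _ V) VV mulmx1 -(mulmxA (V ^t*)) mulmx_diag //.
have TT : T *m T = G *m G ^t*.
  rewrite GE VDV; congr (_ *m diag_mx _ *m _).
  by apply/rowP => i; rewrite !mxE -expr2 sqrtCK.
have GT : G *m G ^t* *m T' = T.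
  rewrite GE VDV; congr (_ *m diag_mx _ *m _).
  apply/rowP => i; rewrite !mxE.
  have [->|di] := eqVneq (d 0 i) 0; first by rewrite mul0r sqrtC0.
  by rewrite -{1}(sqrtCK (d 0 i)) expr2 mulfK// sqrtC_eq0.
have TG : T' *m (G *m G ^t*) = T.
  rewrite GE VDV; congr (_ *m diag_mx _ *m _).
  apply/rowP => i; rewrite !mxE.
  have [->|di] := eqVneq (d 0 i) 0; first by rewrite mulr0 sqrtC0.
  by rewrite -{2}(sqrtCK (d 0 i)) expr2 mulKf// sqrtC_eq0.
(* [T T'] is the orthogonal projection onto the range of [T]: the eigenvalues of [1 - T T'] are [1]
   where [d_i = 0] and [0] elsewhere. *)
have pP : psdmx (1%:M - T *m T').
  rewrite VDV; set p := (\row_ _ _).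
  rewrite -VV' -{1}(mulmx1 (V ^t*)) -mulmxBl -mulmxBr.
  rewrite -diag_const_mx -raddfB; set q := (_ - _).
  pose h := \row_i sqrtC (q 0 i).
  have q0 i : 0 <= q 0 i.
    rewrite !mxE; have [->|di] := eqVneq (d 0 i) 0.
      by rewrite sqrtC0 mul0r subr0.
    by rewrite mulfV ?subrr// sqrtC_eq0.
  have := psdmx_gram (V ^t* *m diag_mx h).
  rewrite ctrmxM trmxCK ctrmx_diag_real; last first.
    by move=> i; rewrite mxE ger0_real// sqrtC_ge0.
  rewrite mulmxA -(mulmxA (V ^t*)) mulmx_diag.
  suff -> : \row_j (h 0 j * h 0 j) = q by [].
  by apply/rowP => i; rewrite mxE [h 0 i]mxE -expr2 sqrtCK.
clearbody T T'.
exists (G ^t* *m T' *m Q *m T' *m G); split.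
- have := psdmx_congrC (G ^t* *m T') pQ.
  by rewrite ctrmxM trmxCK hT' !mulmxA.
- have -> : \tr (G ^t* *m T' *m Q *m T' *m G) =
            \tr (Q *m (T' *m (G *m G ^t*) *m T')).
    rewrite -!mulmxA (mxtrace_mulC (G ^t*)) -!mulmxA (mxtrace_mulC T').
    by rewrite !mulmxA.
  (* The two traces differ by [tr (Q (1 - T T'))], a trace of a product of semidefinite matrices. *)
  rewrite -subr_ge0 -raddfB -{1}(mulmx1 Q) -mulmxBr TG.
  exact: psdmx_trM_ge0.
- have -> : G *m (G ^t* *m T' *m Q *m T' *m G) *m G ^t* =
            (G *m G ^t* *m T') *m Q *m (T' *m (G *m G ^t*)).
    by rewrite !mulmxA.
  (* Sylvester's identity leads from [T Q T] to [Q T^2 = Q G G^H], and a second time to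
     [G^H Q G]. *)
  rewrite GT TG -(mulmxA T) [LHS]det_1DC -(mulmxA Q) TT (mulmxA Q) [LHS]det_1DC.
  by rewrite mulmxA.
Qed.

(** Whitening on both sides: the factors [A = L L^H] and [B = D D^H] reduce the claim to unit noise,
    with channel [G = L^{-1} H D^{-H}] and input [L^H Q L]. Then [S = D^{-H} S' D^{-1}] undoes the
    change of variables. *)
Lemma single_user m n (H : 'M[C]_(n, m)) (A Q : 'M[C]_n) (B : 'M[C]_m) :
  pdmx A -> pdmx B -> psdmx Q ->
  exists S : 'M[C]_m, [/\ psdmx S, \tr (B *m S) <= \tr (A *m Q) &
    \det (A + H *m S *m H ^t*) * \det B = \det (B + H ^t* *m Q *m H) * \det A].
Proof.
move=> [L uL AE] [D uD BE] pQ.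
pose G := invmx L *m H *m (invmx D) ^t*.
have [S' [pS' trS' detS']] := flip_channel G (psdmx_congr L pQ).
have uD' : D ^t* \in unitmx by rewrite ctrmx_unit.
have uL' : L ^t* \in unitmx by rewrite ctrmx_unit.
exists ((invmx D) ^t* *m S' *m invmx D); split.
- exact: psdmx_congr.
- have -> : \tr (B *m ((invmx D) ^t* *m S' *m invmx D)) = \tr S'.
    by rewrite BE ctrmx_inv !mulmxA mulmxK// mxtrace_mulC mulKmx.
  apply: (le_trans trS').
  by rewrite AE mxtrace_mulC !mulmxA.
- have -> : A + H *m ((invmx D) ^t* *m S' *m invmx D) *m H ^t* =
            L *m (1%:M + G *m S' *m G ^t*) *m L ^t*.
    rewrite mulmxDr mulmxDl mulmx1 -AE; congr (_ + _).
    rewrite /G !ctrmxM trmxCK !mulmxA mulmxV// mul1mx ctrmx_inv.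
    by rewrite !(ctrmx_inv L) mulmxKV.
  have -> : B + H ^t* *m Q *m H =
            D *m (1%:M + G ^t* *m (L ^t* *m Q *m L) *m G) *m D ^t*.
    rewrite mulmxDr mulmxDl mulmx1 -BE; congr (_ + _).
    rewrite /G !ctrmxM trmxCK !mulmxA mulmxV// mul1mx !ctrmx_inv.
    by rewrite !mulmxKV// mulmxK.
  rewrite !det_mulmx detS' AE BE !det_mulmx.
  ring.
Qed.

End Psd.

(** Recursion along [rk]: the condition at [i] depends only on values of smaller rank, so values can
    be chosen rank by rank. This builds the covariances user by user, in either order. *)
Lemma ranked_choice (I : finType) (T : Type) (x0 : T) (rk : I -> nat)
    (P : I -> (I -> T) -> T -> Prop) :
  (forall i S S' x, (forall j, (rk j < rk i)%N -> S j = S' j) ->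
    P i S x -> P i S' x) ->
  (forall i S, (forall j, (rk j < rk i)%N -> P j S (S j)) -> exists x, P i S x) ->
  exists S, forall i, P i S (S i).
Proof.
move=> Pext Pex.
suff /(_ (\max_i rk i).+1)[S PS] :
    forall n, exists S, forall i, (rk i < n)%N -> P i S (S i).
  by exists S => i; apply: PS; rewrite ltnS leq_bigmax.
elim=> [|n [S PS]]; first by exists (fun=> x0).
have /choice[x Px] : forall i, exists x, rk i = n -> P i S x.
  move=> i; have [rn|/eqP rn] := eqVneq (rk i) n; last by exists x0.
  have [j|x Px] := Pex i S; first by rewrite rn; exact: PS.
  by exists x.
(* Only values of rank [n] change, so by [Pext] the conditions already met at smaller ranks
   persist. *)
exists (fun i => if rk i == n then x i else S i) => i; rewrite ltnS => rin.
apply: (Pext i S) => [j rji|].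
  by rewrite ltn_eqF// (leq_trans rji).
case: eqVneq => [/Px//|rn]; apply: PS.
by rewrite ltn_neqAle rn.
Qed.

(** * Duality of the broadcasting and multiple access channels at unit noise *)

Section Duality.
Local Open Scope complex_scope.
Context (R : realType) (M N K : nat).
Variable H : 'I_K -> 'M[R[i]]_(N, M).

(** [P] is [ltn] for noise and interference alone, [leq] to include the user's own signal. In
    [mac_noise] the arguments of [P] are swapped, which reverses the decoding order. *)
Definition bc_noise (P : rel nat) (S : 'I_K -> 'M[R[i]]_M) (i : 'I_K) : 'M[R[i]]_N :=
  1%:M + H i *m (\sum_(j < K | P j i) S j) *m (H i) ^t*.

Definition mac_noise (P : rel nat) (Q : 'I_K -> 'M[R[i]]_N) (i : 'I_K) : 'M[R[i]]_M :=
  1%:M + \sum_(j < K | P i j) (H j) ^t* *m Q j *m H j.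

Lemma bc_noise_leq S i :
  bc_noise leq S i = bc_noise ltn S i + H i *m S i *m (H i) ^t*.
Proof.
rewrite /bc_noise (bigD1 i)//= -addrA -mulmxDl -mulmxDr.
rewrite (addrC (S i)); congr (_ + _ *m (_ + _) *m _).
by apply: eq_bigl => j; rewrite /= ltn_neqAle andbC.
Qed.

Lemma mac_noise_leq Q i :
  mac_noise leq Q i = mac_noise ltn Q i + (H i) ^t* *m Q i *m H i.
Proof.
rewrite /mac_noise (bigD1 i)//= -addrA (addrC (_ *m H i)); do 2 congr (_ + _).
by apply: eq_bigl => j; rewrite /= ltn_neqAle andbC eq_sym.
Qed.

Lemma pdmx_bc_noise (P : rel nat) S (i : 'I_K) :
  (forall j : 'I_K, P j i -> psdmx (S j)) -> pdmx (bc_noise P S i).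
Proof. by move=> pS; apply/pdmx1D/psdmx_congrC/psdmx_sum. Qed.

Lemma pdmx_mac_noise (P : rel nat) Q (i : 'I_K) :
  (forall j : 'I_K, P i j -> psdmx (Q j)) -> pdmx (mac_noise P Q i).
Proof. by move=> pQ; apply/pdmx1D/psdmx_sum => j Pj; exact/psdmx_congr/pQ. Qed.

(* Each interference term [tr (H_j^H Q_j H_j S_i)], [i < j], occurs once on each
   side. *)
Lemma cross_power S Q :
  \sum_i \tr (mac_noise ltn Q i *m S i) + \sum_i \tr (Q i) =
  \sum_i \tr (bc_noise ltn S i *m Q i) + \sum_i \tr (S i).
Proof.
have -> : \sum_i \tr (mac_noise ltn Q i *m S i) =
   \sum_i \tr (S i) +
   \sum_(i < K) \sum_(j < K | (i < j)%N) \tr ((H j) ^t* *m Q j *m H j *m S i).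
  rewrite -big_split; apply: eq_bigr => i _ /=.
  by rewrite mulmxDl mul1mx raddfD /= mulmx_suml raddf_sum.
have -> : \sum_i \tr (bc_noise ltn S i *m Q i) =
   \sum_i \tr (Q i) +
   \sum_(j < K) \sum_(i < K | (i < j)%N) \tr ((H j) ^t* *m Q j *m H j *m S i).
  rewrite -big_split; apply: eq_bigr => i _ /=.
  rewrite mulmxDl mul1mx raddfD /= mulmx_sumr !mulmx_suml raddf_sum.
  congr (_ + _); apply: eq_bigr => j _ /=.
  by rewrite -!mulmxA (mxtrace_mulC (H i)) -!mulmxA (mxtrace_mulC (S j)) -!mulmxA.
rewrite [LHS]addrAC [RHS]addrAC; congr (_ + _); first by rewrite addrC.
by rewrite (exchange_big_dep xpredT).
Qed.

(** Each user has the same rate in both channels, stated as an equality of determinant ratios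
    cleared of denominators. *)
Definition dual_pair S Q := forall i,
  \det (bc_noise leq S i) * \det (mac_noise ltn Q i) =
  \det (mac_noise leq Q i) * \det (bc_noise ltn S i).

(** [S_i] is obtained from [single_user] in increasing order of [i], since [bc_noise ltn S i]
    involves earlier users only. The summed trace inequalities and [cross_power] then bound the
    total power. *)
Lemma mac_to_bc Q : psd_tuples Q -> exists S,
  [/\ psd_tuples S, dual_pair S Q & \sum_i \tr (S i) <= \sum_i \tr (Q i)].
Proof.
move=> pQ.
pose P (i : 'I_K) S X := [/\ psdmx X,
  \tr (mac_noise ltn Q i *m X) <= \tr (bc_noise ltn S i *m Q i) &
  \det (bc_noise ltn S i + H i *m X *m (H i) ^t*) * \det (mac_noise ltn Q i) =
  \det (mac_noise ltn Q i + (H i) ^t* *m Q i *m H i) * \det (bc_noise ltn S i)].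
have [|i S pS|S PS] := @ranked_choice _ _ (0 : 'M[R[i]]_M) (@nat_of_ord K) P.
- move=> i S S' X SS'; suff E : bc_noise ltn S i = bc_noise ltn S' i.
    by rewrite /P E.
  by congr (_ + _ *m _ *m _); exact: eq_bigr.
- apply: single_user; last exact: pQ.
  + by apply: pdmx_bc_noise => j /pS[].
  + by apply: pdmx_mac_noise => j _; exact: pQ.
exists S; split=> [i|i|]; first by have [] := PS i.
  by rewrite bc_noise_leq mac_noise_leq; have [] := PS i.
rewrite -(lerD2l (\sum_i \tr (bc_noise ltn S i *m Q i))) -cross_power lerD2r.
by apply: ler_sum => i _; have [] := PS i.
Qed.

Lemma bc_to_mac S : psd_tuples S -> exists Q,
  [/\ psd_tuples Q, dual_pair S Q & \sum_i \tr (Q i) <= \sum_i \tr (S i)].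
Proof.
move=> pS.
pose P (i : 'I_K) Q X := [/\ psdmx X,
  \tr (bc_noise ltn S i *m X) <= \tr (mac_noise ltn Q i *m S i) &
  \det (mac_noise ltn Q i + (H i) ^t* *m X *m H i) * \det (bc_noise ltn S i) =
  \det (bc_noise ltn S i + H i *m S i *m (H i) ^t*) * \det (mac_noise ltn Q i)].
(* In the dual channel the noise of user [i] comes from later users; the rank [K - i], strictly
   decreasing for [i < K], makes these come first. *)
have [|i Q pQ|Q PQ] := @ranked_choice _ _ (0 : 'M[R[i]]_N) (fun i : 'I_K => K - i)%N P.
- move=> i Q Q' X QQ'; suff E : mac_noise ltn Q i = mac_noise ltn Q' i.
    by rewrite /P E.
  congr (_ + _); apply: eq_bigr => j ij; rewrite QQ'//.
  by rewrite ltn_sub2l.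
- have := @single_user _ _ _ ((H i) ^t*) (mac_noise ltn Q i) (S i) (bc_noise ltn S i).
  rewrite trmxCK; apply; last exact: pS.
  + by apply: pdmx_mac_noise => j ij; have [] := pQ j; rewrite ?ltn_sub2l.
  + by apply: pdmx_bc_noise => j _; exact: pS.
exists Q; split=> [i|i|]; first by have [] := PQ i.
  by rewrite bc_noise_leq mac_noise_leq; have [_ _ ->] := PQ i.
rewrite -(lerD2l (\sum_i \tr (mac_noise ltn Q i *m S i))) cross_power lerD2r.
by apply: ler_sum => i _; have [] := PQ i.
Qed.

Lemma log2_div (x y : R) : 0 < x -> 0 < y -> log2 (x / y) = log2 x - log2 y.
Proof. by move=> x0 y0; rewrite /log2 ln_div ?posrE// mulrBl. Qed.

Lemma dual_pair_rate S Q : psd_tuples S -> psd_tuples Q -> dual_pair S Q ->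
  \sum_i log2 (rdet (bc_noise leq S i) / rdet (bc_noise ltn S i)) =
  log2 (rdet (1%:M + \sum_i (H i) ^t* *m Q i *m H i)).
Proof.
move=> pS pQ SQ.
(* [b i] and [b i.+1] belong to [mac_noise leq Q i] and [mac_noise ltn Q i], as [i < j] is
   [i.+1 <= j] by definition. *)
pose b k := log2 (rdet (1%:M + \sum_(j < K | (k <= j)%N) (H j) ^t* *m Q j *m H j)).
have pbn P i : pdmx (bc_noise P S i) by apply: pdmx_bc_noise => j _; exact: pS.
have pmn P i : pdmx (mac_noise P Q i) by apply: pdmx_mac_noise => j _; exact: pQ.
transitivity (\sum_(i < K) (b i - b i.+1)).
  apply: eq_bigr => i _.
  rewrite -log2_div; [|exact/pdmx_rdet_gt0/(pmn leq)|exact/pdmx_rdet_gt0/(pmn ltn)].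
  have b0 : rdet (bc_noise ltn S i) != 0 by rewrite gt_eqF// pdmx_rdet_gt0.
  have m0 : rdet (mac_noise ltn Q i) != 0.
    by rewrite gt_eqF//; exact/pdmx_rdet_gt0/(pmn ltn).
  congr log2; apply/eqP; rewrite eqr_div//; apply/eqP; apply: complexI.
  have := SQ i; rewrite (pdmx_detE (pbn leq i)) (pdmx_detE (pbn ltn i)).
  by rewrite (pdmx_detE (pmn leq i)) (pdmx_detE (pmn ltn i)) -!rmorphM => ->.
rewrite -(big_mkord xpredT (fun i => b i - b i.+1)).
rewrite (eq_bigr (fun i => - (b i.+1 - b i))); last by move=> i _; rewrite opprB.
(* The sum telescopes to [b 0 - b K], and [b K = log2 1 = 0] because no index reaches [K]. *)
rewrite sumrN telescope_sumr// opprB {2}/b big_pred0; last first.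
  by move=> j; rewrite leqNgt ltn_ord.
rewrite addr0; have -> : rdet (1%:M : 'M[R[i]]_M) = 1 by rewrite /rdet det1.
by have -> : log2 1 = 0 :> R; rewrite ?subr0// /log2 ln1 mul0r.
Qed.

End Duality.

(** * Rates at noise power [sigma2] *)

Section Rate.
Local Open Scope complex_scope.
Context (R : realType) (M N K : nat).
Variables (H : 'I_K -> 'M[R[i]]_(N, M)) (W sigma2 : R).
Hypothesis sigma2_gt0 : 0 < sigma2.

Definition mac_gram (Q : 'I_K -> 'M[R[i]]_N) : 'M[R[i]]_M :=
  1%:M + (sigma2^-1)%:C *: \sum_(i < K) (H i) ^t* *m Q i *m H i.

Definition mac_rate Q : R := W * log2 (rdet (mac_gram Q)).

(** Absorbing the noise power into the channels reduces the rates to unit noise. *)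
Let G i := (Num.sqrt sigma2^-1)%:C *: H i.

Let G_ctr i : (G i) ^t* = (Num.sqrt sigma2^-1)%:C *: (H i) ^t*.
Proof.
by rewrite ctrmxZ conj_Creal// ger0_real// ler0c sqrtr_ge0.
Qed.

Let sqrts : (Num.sqrt sigma2^-1)%:C * (Num.sqrt sigma2^-1)%:C = (sigma2^-1)%:C :> R[i].
Proof. by rewrite -rmorphM /= -expr2 sqr_sqrtr// invr_ge0 ltW. Qed.

Let mac_gramE Q : mac_gram Q = 1%:M + \sum_i (G i) ^t* *m Q i *m G i.
Proof.
congr (_ + _); rewrite scaler_sumr; apply: eq_bigr => i _.
by rewrite G_ctr -!scalemxAl -scalemxAr scalerA sqrts.
Qed.

Let bc_noise_detE (P : rel nat) S (i : 'I_K) :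
  bc_noise_det H sigma2 i (\sum_(j < K | P j i) S j) = rdet (bc_noise G P S i).
Proof.
congr (rdet (_ + _)).
by rewrite G_ctr -!scalemxAl -scalemxAr scalerA sqrts.
Qed.

Let bc_sum_rateE S : bc_sum_rate H W sigma2 S =
  W * \sum_i log2 (rdet (bc_noise G leq S i) / rdet (bc_noise G ltn S i)).
Proof.
rewrite mulr_sumr; apply: eq_bigr => i _.
by rewrite (bc_noise_detE leq) (bc_noise_detE ltn).
Qed.

Lemma pdmx_mac_gram Q : psd_tuples Q -> pdmx (mac_gram Q).
Proof.
move=> pQ; apply/pdmx1D/psdmxZ; first by rewrite ler0c invr_ge0 ltW.
by apply/psdmx_sum => i _; exact/psdmx_congr/pQ.
Qed.

Lemma sum_rtr_le m n (A : 'I_K -> 'M[R[i]]_m) (B : 'I_K -> 'M[R[i]]_n) :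
  \sum_i \tr (A i) <= \sum_i \tr (B i) -> \sum_i rtr (A i) <= \sum_i rtr (B i).
Proof.
move=> /le_Re; rewrite !(raddf_sum (@complex.Re R : Rcomplex R -> R)) //.
Qed.

Lemma mac_rate_le_bc Q : psd_tuples Q -> exists S, [/\ psd_tuples S,
  \sum_i rtr (S i) <= \sum_i rtr (Q i) & bc_sum_rate H W sigma2 S = mac_rate Q].
Proof.
move=> pQ; have [S [pS SQ tS]] := mac_to_bc G pQ.
exists S; split => //; first exact: sum_rtr_le.
by rewrite bc_sum_rateE (dual_pair_rate pS pQ SQ) /mac_rate mac_gramE.
Qed.

Lemma bc_rate_le_mac S : psd_tuples S -> exists Q, [/\ psd_tuples Q,
  \sum_i rtr (Q i) <= \sum_i rtr (S i) & mac_rate Q = bc_sum_rate H W sigma2 S].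
Proof.
move=> pS; have [Q [pQ SQ tQ]] := bc_to_mac G pS.
exists Q; split => //; first exact: sum_rtr_le.
by rewrite bc_sum_rateE (dual_pair_rate pS pQ SQ) /mac_rate mac_gramE.
Qed.

End Rate.

(** * Continuity of complex-valued and matrix-valued maps *)

Section ComplexContinuity.
Context (R : realType) (T : topologicalType).

(** Going through real and imaginary parts reduces every continuity check to real-valued
    functions. *)
Definition ccont (f : T -> R[i]) : Prop :=
  continuous (fun v => complex.Re (f v)) /\
  continuous (fun v => complex.Im (f v)).

Lemma ccont_cst (c : R[i]) : ccont (fun=> c).
Proof. by split=> x; exact: cvg_cst. Qed.

Lemma ccontD (f g : T -> R[i]) : ccont f -> ccont g -> ccont (fun v => f v + g v).
Proof.
move=> [fr fi] [gr gi]; split=> x.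
- rewrite (_ : (fun v => _) = (fun v => complex.Re (f v) + complex.Re (g v))).
    by apply: cvgD; [exact: fr|exact: gr].
  by apply/funext => v; case: (f v) (g v) => ? ? [].
- rewrite (_ : (fun v => _) = (fun v => complex.Im (f v) + complex.Im (g v))).
    by apply: cvgD; [exact: fi|exact: gi].
  by apply/funext => v; case: (f v) (g v) => ? ? [].
Qed.

Lemma ccontM (f g : T -> R[i]) : ccont f -> ccont g -> ccont (fun v => f v * g v).
Proof.
move=> [fr fi] [gr gi]; split=> x.
- rewrite (_ : (fun v => _) = (fun v => complex.Re (f v) * complex.Re (g v) -
      complex.Im (f v) * complex.Im (g v))).
    by apply: cvgB; apply: cvgM; [exact: fr|exact: gr|exact: fi|exact: gi].
  by apply/funext => v; case: (f v) (g v) => ? ? [].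
- rewrite (_ : (fun v => _) = (fun v => complex.Re (f v) * complex.Im (g v) +
      complex.Im (f v) * complex.Re (g v))).
    by apply: cvgD; apply: cvgM; [exact: fr|exact: gi|exact: fi|exact: gr].
  by apply/funext => v; case: (f v) (g v) => ? ? [].
Qed.

Lemma ccont_conj (f : T -> R[i]) : ccont f -> ccont (fun v => Num.conj (f v)).
Proof.
move=> [fr fi]; split=> x.
- rewrite (_ : (fun v => _) = (fun v => complex.Re (f v))); first exact: fr.
  by apply/funext => v; case: (f v).
- rewrite (_ : (fun v => _) = (fun v => - complex.Im (f v))).
    by apply: cvgN; exact: fi.
  by apply/funext => v; case: (f v).
Qed.

Lemma ccont_sum (I : Type) (r : seq I) (P : pred I) (f : I -> T -> R[i]) :
  (forall i, ccont (f i)) -> ccont (fun v => \sum_(i <- r | P i) f i v).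
Proof.
move=> cf; elim: r => [|i r IH].
  by under eq_fun do rewrite big_nil; exact: ccont_cst.
under eq_fun do rewrite big_cons; case: (P i) => //.
exact: ccontD.
Qed.

Lemma ccont_prod (I : Type) (r : seq I) (P : pred I) (f : I -> T -> R[i]) :
  (forall i, ccont (f i)) -> ccont (fun v => \prod_(i <- r | P i) f i v).
Proof.
move=> cf; elim: r => [|i r IH].
  by under eq_fun do rewrite big_nil; exact: ccont_cst.
under eq_fun do rewrite big_cons; case: (P i) => //.
exact: ccontM.
Qed.

Definition mxcont m n (A : T -> 'M[R[i]]_(m, n)) : Prop :=
  forall a b, ccont (fun v => A v a b).

Lemma mxcont_cst m n (A : 'M[R[i]]_(m, n)) : mxcont (fun=> A).
Proof. by move=> a b; exact: ccont_cst. Qed.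

Lemma mxcontD m n (A B : T -> 'M[R[i]]_(m, n)) : mxcont A -> mxcont B ->
  mxcont (fun v => A v + B v).
Proof.
by move=> cA cB a b; under eq_fun do rewrite mxE; exact: ccontD.
Qed.

Lemma mxcont_sum (I : Type) (r : seq I) m n (A : I -> T -> 'M[R[i]]_(m, n)) :
  (forall i, mxcont (A i)) -> mxcont (fun v => \sum_(i <- r) A i v).
Proof.
by move=> cA a b; under eq_fun do rewrite summxE; apply: ccont_sum => i; exact: cA.
Qed.

Lemma mxcontM m n p (A : T -> 'M[R[i]]_(m, n)) (B : T -> 'M[R[i]]_(n, p)) :
  mxcont A -> mxcont B -> mxcont (fun v => A v *m B v).
Proof.
move=> cA cB a b; under eq_fun do rewrite mxE.
by apply: ccont_sum => i; exact: ccontM.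
Qed.

Lemma mxcontZ m n (c : R[i]) (A : T -> 'M[R[i]]_(m, n)) : mxcont A ->
  mxcont (fun v => c *: A v).
Proof.
move=> cA a b; under eq_fun do rewrite mxE.
by apply: ccontM => //; exact: ccont_cst.
Qed.

Lemma mxcont_ctr m n (A : T -> 'M[R[i]]_(m, n)) : mxcont A ->
  mxcont (fun v => (A v) ^t*).
Proof. by move=> cA a b; under eq_fun do rewrite !mxE; exact: ccont_conj. Qed.

Lemma continuous_rtr n (A : T -> 'M[R[i]]_n) : mxcont A ->
  continuous (fun v => rtr (A v)).
Proof.
by move=> cA; have [] := @ccont_sum _ (index_enum 'I_n) xpredT _ (fun i => cA i i).
Qed.

Lemma continuous_rdet n (A : T -> 'M[R[i]]_n) : mxcont A ->
  continuous (fun v => rdet (A v)).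
Proof.
move=> cA; suff [] : ccont (fun v => \det (A v)) by [].
(* By the Leibniz formula the determinant is a signed sum over permutations [s] of products of
   entries. *)
apply: ccont_sum => s; apply: ccontM; first exact: ccont_cst.
by apply: ccont_prod => i; exact: cA.
Qed.

Lemma continuous_sumr (I : Type) (r : seq I) (f : I -> T -> R) :
  (forall i, continuous (f i)) -> continuous (fun v => \sum_(i <- r) f i v).
Proof.
move=> cf x; elim: r => [|i r IH].
  by under eq_fun do rewrite big_nil; exact: cvg_cst.
under eq_fun do rewrite big_cons.
by apply: cvgD => //; exact: cf.
Qed.

End ComplexContinuity.

(** * Maxima under a power constraint *)

Section PsdTuples.
Local Open Scope complex_scope.
Context (R : realType) (K n : nat).

Lemma psdmx_factor (A : 'M[R[i]]_n) : psdmx A -> exists B : 'M[R[i]]_n, A = B *m B ^t*.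
Proof.
move=> /psdmx_spectral[V [d d0 [VV VV' ->]]].
pose e := \row_i sqrtC (d 0 i); exists (V ^t* *m diag_mx e).
rewrite ctrmxM trmxCK ctrmx_diag_real; last first.
  by move=> i; rewrite mxE ger0_real// sqrtC_ge0.
rewrite [RHS]mulmxA -[in RHS](mulmxA (V ^t*)) mulmx_diag; congr (_ *m diag_mx _ *m _).
by apply/rowP => i; rewrite !mxE -expr2 sqrtCK.
Qed.

(* Writing [Q_i = B_i B_i^H], the power constraint [\sum_i tr Q_i <= P] bounds
   the squared entries of the [B_i], which are arbitrary; so no closedness of
   the semidefinite cone is needed. *)
Let I : finType := ('I_K * 'I_n * 'I_n * bool)%type.

Let factor (v : 'rV[R]_#|{: I}|) (i : 'I_K) : 'M[R[i]]_n :=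
  \matrix_(a, b) (v 0 (enum_rank ((i, a, b, false) : I)) +i*
                  v 0 (enum_rank ((i, a, b, true) : I))).

Let gram (v : 'rV[R]_#|{: I}|) (i : 'I_K) := factor v i *m (factor v i) ^t*.

Let factor_cont i : mxcont (fun v => factor v i).
Proof.
move=> a b; split.
- under eq_fun do rewrite mxE /=; exact: coord_continuous.
- under eq_fun do rewrite mxE /=; exact: coord_continuous.
Qed.

Let gram_cont i : mxcont (fun v => gram v i).
Proof. by apply: mxcontM => //; exact: mxcont_ctr. Qed.

Let gram_surj Q : psd_tuples Q -> exists v, gram v = Q.
Proof.
move=> pQ; have /choice[B BE] : forall i, exists B : 'M[R[i]]_n, Q i = B *m B ^t*.
  by move=> i; exact/psdmx_factor/pQ.
pose w (k : I) := let: (i, a, b, c) := k in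
  if c then complex.Im (B i a b) else complex.Re (B i a b).
exists (\row_k w (enum_val k)); apply/funext => i; rewrite BE /gram.
suff -> : factor (\row_k w (enum_val k)) i = B i by [].
apply/matrixP => a b; rewrite !mxE !enum_rankK /=.
by case: (B i a b).
Qed.

(** This is the squared Frobenius norm of the factor, so the power constraint describes a Euclidean
    ball in [v]. *)
Let rtr_gram v i :
  rtr (gram v i) = \sum_a \sum_b ((v 0 (enum_rank ((i, a, b, false) : I))) ^+ 2 +
                                  (v 0 (enum_rank ((i, a, b, true) : I))) ^+ 2).
Proof.
rewrite /rtr /mxtrace (raddf_sum (@complex.Re R : Rcomplex R -> R)).
apply: eq_bigr => a _; rewrite mxE (raddf_sum (@complex.Re R : Rcomplex R -> R)).
apply: eq_bigr => b _; rewrite !mxE /=.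
by rewrite mulrN opprK !expr2.
Qed.

(** Continuity of [F] is expressed along continuous families of tuples, which avoids a topology on
    tuples. It is applied to the family [gram], and the extreme value theorem is used in the
    parameter [v]. *)
Lemma psd_tuples_EVT (F : ('I_K -> 'M[R[i]]_n) -> R) (P : R) : 0 <= P ->
  (forall (T : topologicalType) (A : T -> 'I_K -> 'M[R[i]]_n),
    (forall v, psd_tuples (A v)) -> (forall i, mxcont (fun v => A v i)) ->
    continuous (fun v => F (A v))) ->
  exists Q, attains_max [set Q | psd_tuples Q /\ \sum_(i < K) rtr (Q i) <= P] F Q.
Proof.
move=> P0 cF; have pgram v : psd_tuples (gram v) by move=> i; exact: psdmx_gram.
pose D := [set v | \sum_(i < K) rtr (gram v i) <= P].
have D0 : D !=set0.
  have [v vE] : exists v, gram v = fun=> 0.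
    by apply: gram_surj => i; exact: psdmx0.
  by exists v; rewrite /D /= vE big1// => i _; rewrite /rtr mxtrace0.
have cD : compact D.
  have : compact [set v : 'rV[R]_#|{: I}| |
     forall k, `[- Num.sqrt P, Num.sqrt P]%classic (v 0 k)].
    apply: (@rV_compact R _ (fun=> `[- Num.sqrt P, Num.sqrt P]%classic)) => k.
    exact: segment_compact.
  move=> cB; apply: (subclosed_compact _ cB).
    apply: (@closed_comp _ _ (fun v => \sum_(i < K) rtr (gram v i)) [set x | x <= P]).
      move=> x _; apply: continuous_sumr => i.
      exact: continuous_rtr.
    exact: closed_le.
  (* The square of the coordinate [v_k] is one of the nonnegative terms of the total trace, hence at
     most [P]. *)
  move=> v vP k; rewrite /= in_itv /= -ler_norml.
  rewrite -(ler_pXn2r (n := 2)) ?nnegrE ?sqrtr_ge0// sqr_sqrtr// real_normK ?num_real//.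
  apply: le_trans vP; rewrite -(enum_valK k).
  case: (enum_val k) => [[[i a] b] c].
  rewrite (bigD1 i)//= rtr_gram (bigD1 a)//= (bigD1 b)//= -!addrA.
  have nn (A B : R) : 0 <= B -> A <= A + B by rewrite lerDl.
  have s0 (x y : R) : 0 <= x ^+ 2 + y ^+ 2 by rewrite addr_ge0 ?sqr_ge0.
  case: c; [rewrite addrCA|]; apply: nn; (apply: addr_ge0; first exact: sqr_ge0);
    (apply: addr_ge0; last apply: addr_ge0); apply: sumr_ge0 => j _ //.
  - by apply: sumr_ge0.
  - by rewrite rtr_gram; apply: sumr_ge0 => ? _; apply: sumr_ge0.
  - by apply: sumr_ge0.
  - by rewrite rtr_gram; apply: sumr_ge0 => ? _; apply: sumr_ge0.
have cG : {within D, continuous (fun v => F (gram v))}.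
  by apply/continuous_subspaceT/cF.
have [v] := compact_EVT_max D0 cD cG.
rewrite inE => vD vmax; exists (gram v); split; first by split.
move=> Q [/gram_surj[w <-] wP]; apply: vmax.
by rewrite inE.
Qed.

End PsdTuples.

(** * Real traces and log-determinant inequalities *)

Section RealTrace.
Local Open Scope complex_scope.
Context (R : realType).

Lemma rtrD n (A B : 'M[R[i]]_n) : rtr (A + B) = rtr A + rtr B.
Proof. by rewrite /rtr mxtraceD; case: (\tr A) (\tr B) => ? ? []. Qed.

Lemma rtrZ n (r : R) (A : 'M[R[i]]_n) : rtr (r%:C *: A) = r * rtr A.
Proof. by rewrite /rtr mxtraceZ; case: (\tr A) => ? ? /=; rewrite mul0r subr0. Qed.

Lemma rtr1 n : rtr (1%:M : 'M[R[i]]_n) = n%:R.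
Proof. by rewrite /rtr mxtrace1 -(rmorph_nat (real_complex R)). Qed.

Lemma rtr_ge0 n (A : 'M[R[i]]_n) : psdmx A -> 0 <= rtr A.
Proof. by move=> /psdmx_tr_ge0 /le_Re. Qed.

Lemma rtr_sum (I : Type) (r : seq I) n (A : I -> 'M[R[i]]_n) :
  rtr (\sum_(i <- r) A i) = \sum_(i <- r) rtr (A i).
Proof.
elim: r => [|i r IH]; first by rewrite !big_nil /rtr mxtrace0.
by rewrite !big_cons rtrD IH.
Qed.

(** In an eigenbasis of [A] the left side is a sum of [d_i B'_ii], and each [B'_ii] is at most
    [tr B']. *)
Lemma rtrM_le n (A B : 'M[R[i]]_n) : psdmx A -> psdmx B ->
  rtr (A *m B) <= rtr A * rtr B.
Proof.
move=> pA pB; have [V [d d0 [VV VV' AE]]] := psdmx_spectral pA.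
suff : \tr (A *m B) <= \tr A * \tr B.
  rewrite {1}(RRe_ge0 (psdmx_tr_ge0 pA)) {1}(RRe_ge0 (psdmx_tr_ge0 pB)).
  by rewrite -rmorphM => /le_Re.
pose B' := V *m B *m V ^t*.
have pB' : psdmx B' by exact: psdmx_congrC.
have -> : \tr (A *m B) = \tr (diag_mx d *m B').
  by rewrite AE -!mulmxA mxtrace_mulC !mulmxA.
have -> : \tr A = \sum_i d 0 i.
  by rewrite AE -mulmxA mxtrace_mulC -mulmxA VV mulmx1 mxtrace_diag.
have -> : \tr B = \tr B' by rewrite /B' mxtrace_mulC mulmxA VV' mul1mx.
rewrite mulr_suml; apply: ler_sum => i _; rewrite mul_diag_mx mxE.
apply: ler_wpM2l => //; rewrite /mxtrace (bigD1 i)//= lerDl.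
by apply: sumr_ge0 => j _; exact: psdmx_diag_ge0.
Qed.

(** The tangent inequality at [Z] is applied to [X] and [Y]; the weighted linear terms add up to
    [tr (Z^{-1} Z) = n] and cancel the constant. *)
Lemma ln_det_concave n (X Y : 'M[R[i]]_n) (t : R) : 0 <= t <= 1 ->
  pdmx X -> pdmx Y -> pdmx (t%:C *: X + (1 - t)%:C *: Y) ->
  t * ln (rdet X) + (1 - t) * ln (rdet Y) <=
  ln (rdet (t%:C *: X + (1 - t)%:C *: Y)).
Proof.
move=> /andP[t0 t1] pX pY; set Z := (_ + _) => pZ.
have hX := ln_det_tangent pZ pX; have hY := ln_det_tangent pZ pY.
have E : t * rtr (invmx Z *m X) + (1 - t) * rtr (invmx Z *m Y) = n%:R.
  by rewrite -!rtrZ -rtrD !scalemxAr -mulmxDr mulVmx ?rtr1// pdmx_unit.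
nra.
Qed.

Lemma pdmx_scalar n (k : R) : 0 < k -> pdmx (k%:C%:M : 'M[R[i]]_n).
Proof.
move=> k0; exists ((Num.sqrt k)%:C%:M).
  rewrite unitmxE det_scalar unitrX// unitfE eq_complex /= eqxx andbT.
  by rewrite gt_eqF// sqrtr_gt0.
rewrite -(scalemx1 _ k%:C) -(scalemx1 _ (Num.sqrt k)%:C) ctrmxZ ctrmx1.
rewrite -scalemxAl mul1mx scalerA conj_Creal; last first.
  by rewrite ger0_real// ler0c sqrtr_ge0.
by rewrite -rmorphM /= -expr2 sqr_sqrtr// ltW.
Qed.

(** The tangent at [k I]: a large [k] makes the slope [1 / k] in the trace as small as desired. *)
Lemma ln_det_le_scaled n (k : R) (Y : 'M[R[i]]_n) : 0 < k -> pdmx Y ->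
  ln (rdet Y) <= n%:R * ln k + rtr Y / k - n%:R.
Proof.
move=> k0 pY; have := ln_det_tangent (pdmx_scalar n k0) pY.
have -> : rdet (k%:C%:M : 'M[R[i]]_n) = k ^+ n.
  by rewrite /rdet det_scalar -rmorphXn.
rewrite lnXn// mulr_natl invmx_scalar mul_scalar_mx -fmorphV rtrZ.
by rewrite mulrC.
Qed.

End RealTrace.

(** * Energy efficiency: quasiconcavity, attainment, and comparison of the two maxima *)

Section EnergyEfficiency.
Local Open Scope complex_scope.
Context (R : realType) (M N K : nat).
Variables (H : 'I_K -> 'M[R[i]]_(N, M)) (W sigma2 : R).
Hypotheses (W_gt0 : 0 < W) (sigma2_gt0 : 0 < sigma2).

Local Notation tuples := (@psd_tuples R K N).
Local Notation rate := (mac_rate H W sigma2).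

Let ln2_gt0 : 0 < ln 2 :> R.
Proof. by rewrite ln_gt0// ltr1n. Qed.

Lemma mac_rate0 : rate (fun=> 0) = 0.
Proof.
rewrite /mac_rate /mac_gram big1 => [|i _]; last by rewrite mulmx0 mul0mx.
by rewrite scaler0 addr0 /rdet det1 /log2 ln1 mul0r mulr0.
Qed.

Lemma mac_rate_concave (t : R) Q Q' : 0 <= t <= 1 -> tuples Q -> tuples Q' ->
  t * rate Q + (1 - t) * rate Q' <=
  rate (fun i => t%:C *: Q i + (1 - t)%:C *: Q' i).
Proof.
move=> t01 pQ pQ'; have /andP[t0 t1] := t01.
set Qt := (fun i => _).
have pQt : tuples Qt.
  by move=> i; apply: psdmxD; apply: psdmxZ => //; rewrite ler0c// subr_ge0.
have E : mac_gram H sigma2 Qt =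
    t%:C *: mac_gram H sigma2 Q + (1 - t)%:C *: mac_gram H sigma2 Q'.
  rewrite /mac_gram !scalerDr addrACA -scalerDl -rmorphD /= (addrC t) subrK scale1r.
  congr (_ + _); rewrite !scalerA ![_ * (sigma2^-1)%:C]mulrC -!scalerA -scalerDr.
  congr (_ *: _); rewrite !scaler_sumr -big_split; apply: eq_bigr => i _ /=.
  by rewrite /Qt mulmxDr mulmxDl -!scalemxAr -!scalemxAl.
have := @ln_det_concave _ _ (mac_gram H sigma2 Q) (mac_gram H sigma2 Q') t t01.
rewrite -E => /(_ (pdmx_mac_gram H sigma2_gt0 pQ) (pdmx_mac_gram H sigma2_gt0 pQ')
  (pdmx_mac_gram H sigma2_gt0 pQt)) h.
rewrite /mac_rate /log2 mulrCA (mulrCA (1 - t)) -mulrDr ler_pM2l//.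
by rewrite !mulrA -mulrDl ler_pM2r ?invr_gt0.
Qed.

(** The constant comes from [tr (H_i^H Q_i H_i) = tr (Q_i H_i H_i^H) <= tr Q_i * tr (H_i H_i^H)],
    the last factor being bounded by its sum over all users. *)
Lemma mac_rate_growth : exists2 c : R, 0 <= c & forall (k : R) Q, 0 < k -> tuples Q ->
  rate Q <= W / ln 2 * (M%:R * ln k + (M%:R + c * \sum_i rtr (Q i)) / k - M%:R).
Proof.
exists (sigma2^-1 * \sum_i rtr (H i *m (H i) ^t*)).
  rewrite mulr_ge0 ?invr_ge0 ?(ltW sigma2_gt0)//; apply: sumr_ge0 => i _.
  exact/rtr_ge0/psdmx_gram.
move=> k Q k0 pQ; rewrite /mac_rate /log2 [ln _ / _]mulrC mulrA.
rewrite ler_pM2l ?divr_gt0//.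
apply: (le_trans (ln_det_le_scaled k0 (pdmx_mac_gram H sigma2_gt0 pQ))).
rewrite lerD2r lerD2l ler_pM2r ?invr_gt0//.
rewrite /mac_gram rtrD rtr1 rtrZ rtr_sum lerD2l -mulrA ler_pM2l ?invr_gt0//.
rewrite mulr_sumr; apply: ler_sum => i _.
have -> : rtr ((H i) ^t* *m Q i *m H i) = rtr (Q i *m (H i *m (H i) ^t*)).
  by rewrite /rtr -mulmxA mxtrace_mulC mulmxA.
apply: (le_trans (rtrM_le (pQ i) (psdmx_gram (H i)))).
rewrite [leLHS]mulrC ler_wpM2r ?(rtr_ge0 (pQ i))//.
by rewrite (bigD1 i)//= lerDl; apply: sumr_ge0 => j _; exact/rtr_ge0/psdmx_gram.
Qed.

Lemma mac_rate_cont (T : topologicalType) (A : T -> 'I_K -> 'M[R[i]]_N) :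
  (forall v, tuples (A v)) -> (forall i, mxcont (fun v => A v i)) ->
  continuous (fun v => rate (A v)).
Proof.
move=> pA cA x; apply: cvgM; first exact: cvg_cst.
apply: cvgM; last exact: cvg_cst.
have cD : continuous (fun v => rdet (mac_gram H sigma2 (A v))).
  apply: continuous_rdet; apply: mxcontD; first exact: mxcont_cst.
  apply: mxcontZ; apply: mxcont_sum => i.
  by apply: mxcontM; [apply: mxcontM => //|]; exact: mxcont_cst.
apply: (@continuous_comp _ _ _ (fun v => rdet (mac_gram H sigma2 (A v))) (@ln R)).
  exact: cD.
exact/continuous_ln/pdmx_rdet_gt0/pdmx_mac_gram.
Qed.

Lemma sum_rtr_ge0 Q : tuples Q -> 0 <= \sum_i rtr (Q i).
Proof. by move=> pQ; apply: sumr_ge0 => i _; exact: rtr_ge0. Qed.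

(** A best dual tuple exists by [psd_tuples_EVT]; duality in one direction realises its rate in the
    broadcasting channel, and in the other shows that no feasible [S] exceeds it. *)
Lemma bc_capacity_mac (P : R) : 0 <= P ->
  is_maximum (bc_sum_rate H W sigma2 @` bc_feasible P) (bc_capacity H W sigma2 P) /\
  exists Q, [/\ tuples Q, \sum_i rtr (Q i) <= P, bc_capacity H W sigma2 P = rate Q &
    forall Q', tuples Q' -> \sum_i rtr (Q' i) <= P -> rate Q' <= rate Q].
Proof.
move=> P0; have [Q [[pQ QP] Qmax]] := psd_tuples_EVT P0 mac_rate_cont.
have [S [pS SQ Srate]] := mac_rate_le_bc H W sigma2_gt0 pQ.
have Smax : is_maximum (bc_sum_rate H W sigma2 @` bc_feasible P) (rate Q).
  split; first by exists S => //; split=> //; exact: le_trans QP.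
  move=> _ [S' [pS' S'P] <-].
  have [Q' [pQ' Q'S' <-]] := bc_rate_le_mac H W sigma2_gt0 pS'.
  by apply: Qmax; split => //; exact: le_trans S'P.
have CE : bc_capacity H W sigma2 P = rate Q.
  have [m1 m2] := Smax; apply/eqP; rewrite eq_le; apply/andP; split.
    by apply: ge_sup => //; exists (rate Q).
  by apply: ub_le_sup => //; exists (rate Q).
rewrite CE; split; first exact: Smax.
exists Q; split; [exact: pQ|exact: QP|exact: erefl|move=> Q' pQ' Q'P].
by apply: Qmax; split; [exact: pQ'|exact: Q'P].
Qed.

Variables (eta Pdyn Psta : R).
Hypotheses (eta_gt0 : 0 < eta) (Pdyn_gt0 : 0 < Pdyn) (Psta_gt0 : 0 < Psta).

Local Notation g := (mac_energy_efficiency H W sigma2 eta Pdyn Psta).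
Local Notation EE := (bc_energy_efficiency H W sigma2 eta Pdyn Psta).
Local Notation power := (total_power M eta Pdyn Psta).

Let power_le (P P' : R) : P <= P' -> power P <= power P'.
Proof. by move=> PP'; rewrite !lerD2r ler_pM2r// invr_gt0. Qed.

Let power_gt (P : R) : 0 <= P -> P / eta < power P.
Proof.
by move=> P0; rewrite /total_power -addrA ltrDl ltr_wpDl// mulr_ge0// ltW.
Qed.

Let power_gt0 (P : R) : 0 <= P -> 0 < power P.
Proof. by move=> P0; apply: le_lt_trans (power_gt P0); rewrite divr_ge0// ltW. Qed.

Let gE Q : g Q = rate Q / power (\sum_i rtr (Q i)).
Proof. by []. Qed.

Let le_gE (r : R) Q : tuples Q ->
  (r <= g Q) = (r * power (\sum_i rtr (Q i)) <= rate Q).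
Proof. by move=> pQ; rewrite gE ler_pdivlMr// power_gt0// sum_rtr_ge0. Qed.

(** As the denominator is positive, [s <= g Q] reads [s * power <= rate Q]. The left side is affine
    in [Q] for [s] of either sign and the right side is concave, so the inequality passes to convex
    combinations. *)
Lemma mac_ee_quasiconcave : convex_set tuples /\ quasiconcave_on tuples g.
Proof.
(* A convexity weight lies between [0] and [1] in [R[i]], hence is real; [t] is its real part. *)
have conv_tuples (l : {i01 R[i]}) : exists2 t : R, 0 <= t <= 1 &
    l%:num = t%:C /\ 1 - l%:num = (1 - t)%:C.
  have l0 : 0 <= l%:num by [].
  have l1 : l%:num <= 1 by [].
  exists (complex.Re l%:num).
    by rewrite -!lecR -(RRe_ge0 l0) l0 l1.
  by rewrite rmorphB /= -(RRe_ge0 l0).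
split.
  move=> Q Q' l /set_mem pQ /set_mem pQ'; apply/mem_set => i.
  rewrite /conv /=; have [t /andP[t0 t1] [-> tE]] := conv_tuples l.
  rewrite /unstable.onem tE.
  by apply: psdmxD; apply: psdmxZ => //; rewrite ler0c// subr_ge0.
move=> s Q Q' l /set_mem[pQ sQ] /set_mem[pQ' sQ']; apply/mem_set.
have [t t01 [lE tE]] := conv_tuples l; have /andP[t0 t1] := t01.
have -> : conv l (Q : convex_lmodType _) Q' =
    (fun i => t%:C *: Q i + (1 - t)%:C *: Q' i).
  by apply/funext => i; rewrite /conv /= /unstable.onem tE lE.
have pQt : tuples (fun i => t%:C *: Q i + (1 - t)%:C *: Q' i).
  by move=> i; apply: psdmxD; apply: psdmxZ => //; rewrite ler0c// subr_ge0.
split; first exact: pQt.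
move: sQ sQ'; rewrite (le_gE _ pQ) (le_gE _ pQ') (le_gE _ pQt) => sQ sQ'.
apply: le_trans (mac_rate_concave t01 pQ pQ').
under eq_bigr do rewrite rtrD !rtrZ.
rewrite big_split /= -!mulr_sumr /total_power.
move: sQ sQ'; rewrite /total_power.
move: (\sum_i rtr (Q i)) (\sum_i rtr (Q' i)) (rate Q) (rate Q') => p p' r r' h h'.
have -> : s * ((t * p + (1 - t) * p') / eta + M%:R * Pdyn + Psta) =
  t * (s * (p / eta + M%:R * Pdyn + Psta)) +
  (1 - t) * (s * (p' / eta + M%:R * Pdyn + Psta)).
  by ring.
by apply: lerD; apply: ler_wpM2l; rewrite ?subr_ge0.
Qed.

(** The growth bound is a constant [a] plus a term linear in the power [p]; each is kept within half
    of [e * (p / eta)], which is less than [e] times the total power. *)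
Lemma mac_ee_small (e : R) : 0 < e -> exists2 P : R, 0 <= P &
  forall Q, tuples Q -> P < \sum_i rtr (Q i) -> g Q < e.
Proof.
move=> e0; have [c c0 crate] := mac_rate_growth.
pose w := W / ln 2; have w0 : 0 < w by rewrite divr_gt0.
(* This gives the slope [w * c / k <= e / (2 * eta)]; the [1] keeps [k] positive when [c = 0]. *)
pose k := 2 * w * c * eta / e + 1.
have k0 : 0 < k by rewrite ltr_wpDl// !(mulr_ge0, invr_ge0)// ltW.
pose a := w * (M%:R * ln k + M%:R / k - M%:R).
(* Above [2 * eta * a / e] the constant [a] is below [e * (p / eta) / 2]; the maximum with [0] also
   ensures [p > 0]. *)
exists (Num.max 0 (2 * eta * a / e)); first by rewrite le_max lexx.
move=> Q pQ; set p := \sum_i _; rewrite gt_max => /andP[p0 ap].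
have {}crate := crate k Q k0 pQ.
rewrite gE ltr_pdivrMr ?power_gt0 ?sum_rtr_ge0// -/p.
apply: (le_lt_trans crate); rewrite -/w -/p.
apply: (@lt_trans _ _ (e * (p / eta))); last by rewrite ltr_pM2l// power_gt// ltW.
have -> : w * (M%:R * ln k + (M%:R + c * p) / k - M%:R) = a + w * c / k * p.
  by rewrite /a; field; rewrite gt_eqF.
have h1 : a < e * (p / eta) / 2.
  move: ap; rewrite ltr_pdivrMr// => ap.
  have -> : e * (p / eta) / 2 = p * e / (2 * eta) by field; rewrite gt_eqF.
  by rewrite ltr_pdivlMr ?mulr_gt0// mulrC.
have h2 : w * c / k * p <= e * (p / eta) / 2.
  have -> : e * (p / eta) / 2 = e / (2 * eta) * p by field; rewrite gt_eqF.
  rewrite ler_pM2r// ler_pdivrMr// /k.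
  have -> : e / (2 * eta) * (2 * w * c * eta / e + 1) = w * c + e / (2 * eta).
    by field; rewrite !gt_eqF.
  by rewrite lerDl divr_ge0 ?mulr_ge0 ?ltW.
lra.
Qed.

(** If [g] is positive at some [Q0], then [g < g Q0] beyond some power, and the maximum below that
    power is global. Otherwise [g <= 0], and the zero tuple attains the value [0]. *)
Lemma mac_ee_attains : exists Q, attains_max tuples g Q.
Proof.
have g_cont (T : topologicalType) (A : T -> 'I_K -> 'M[R[i]]_N) :
    (forall v, tuples (A v)) -> (forall i, mxcont (fun v => A v i)) ->
    continuous (fun v => g (A v)).
  move=> pA cA x; apply: cvgM; first exact: mac_rate_cont.
  apply: cvgV; first by rewrite gt_eqF// power_gt0// sum_rtr_ge0.
  apply: cvgD; last exact: cvg_cst.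
  apply: cvgD; last exact: cvg_cst.
  apply: cvgM; last exact: cvg_cst.
  by apply: continuous_sumr => i; exact: continuous_rtr.
have [[Q0 [pQ0 g0]]|g_le0] := pselect (exists Q, tuples Q /\ 0 < g Q).
  have [P P0 gsmall] := mac_ee_small g0.
  have [Q [[pQ QP] Qmax]] := psd_tuples_EVT P0 g_cont.
  exists Q; split=> // Q' pQ'; have [Q'P|PQ'] := leP (\sum_i rtr (Q' i)) P.
    exact: Qmax.
  apply: le_trans (ltW (gsmall _ pQ' PQ')) _; apply: Qmax; split=> //.
  (* [Q0] itself respects the power bound, since otherwise [g Q0 < g Q0]. *)
  by rewrite leNgt; apply/negP => /(gsmall _ pQ0); rewrite ltxx.
exists (fun=> 0); split; first by move=> i; exact: psdmx0.
move=> Q pQ; rewrite [leRHS]gE mac_rate0 mul0r leNgt; apply/negP => gQ.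
by apply: g_le0; exists Q.
Qed.

(** The best dual tuple [Q'] for [P] spends at most [P], so its denominator is no larger; its rate
    is nonnegative by comparison with the zero tuple. *)
Lemma bc_ee_le_mac Q P : attains_max tuples g Q -> 0 <= P -> EE P <= g Q.
Proof.
move=> [pQ Qmax] P0; have [_ [Q' [pQ' Q'P CE Q'max]]] := bc_capacity_mac P0.
apply: le_trans (Qmax Q' pQ').
rewrite /bc_energy_efficiency CE gE; apply: ler_wpM2l.
  rewrite -mac_rate0; apply: Q'max; first by move=> i; exact: psdmx0.
  by rewrite big1// => i _; rewrite /rtr mxtrace0.
by rewrite lef_pV2 ?posrE ?power_gt0 ?sum_rtr_ge0// power_le.
Qed.

(** At the power spent by [Q] the denominators agree, and [Q] competes in the dual form of the
    capacity. *)
Lemma bc_ee_mac Q : attains_max tuples g Q -> EE (\sum_i rtr (Q i)) = g Q.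
Proof.
move=> Qmax; have [pQ _] := Qmax; have P0 := sum_rtr_ge0 pQ.
apply/eqP; rewrite eq_le bc_ee_le_mac//= gE /bc_energy_efficiency.
have [_ [Q' [_ _ -> Q'max]]] := bc_capacity_mac P0.
apply: ler_wpM2r; first by rewrite invr_ge0 ltW// power_gt0.
exact: (Q'max _ pQ (lexx _)).
Qed.

End EnergyEfficiency.

Local Open Scope complex_scope.

Theorem mainTheorem1 (R : realType) (M N K : nat)
    (hM : (1 <= M)%N) (hN : (1 <= N)%N) (hK : (1 <= K)%N)
    (H : 'I_K -> 'M[R[i]]_(N, M)) (W sigma2 eta Pdyn Psta : R)
    (hW : 0 < W) (hsigma2 : 0 < sigma2) (heta : 0 < eta)
    (hPdyn : 0 < Pdyn) (hPsta : 0 < Psta) :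
  let g := mac_energy_efficiency H W sigma2 eta Pdyn Psta in
  let EE := bc_energy_efficiency H W sigma2 eta Pdyn Psta in
  [/\ (* the supremum defining the sum capacity is a maximum *)
      forall P : R, 0 <= P ->
        is_maximum (bc_sum_rate H W sigma2 @` bc_feasible P)
                   (bc_capacity H W sigma2 P),
      (convex_set (@psd_tuples R K N) /\
       quasiconcave_on (@psd_tuples R K N) g),
      (exists m : R, is_maximum (EE @` [set P | 0 <= P]) m /\
                     is_maximum (g @` @psd_tuples R K N) m) &
      forall Q : 'I_K -> 'M[R[i]]_N,
        attains_max (@psd_tuples R K N) g Q ->
        attains_max [set P | 0 <= P] EE (\sum_(i < K) rtr (Q i))].
Proof.
move=> g EE; split.
- by move=> P P0; have [] := bc_capacity_mac H W hsigma2 P0.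
- exact: mac_ee_quasiconcave.
- have [Q Qmax] := mac_ee_attains H hW hsigma2 heta hPdyn hPsta.
  have [pQ Qge] := Qmax; exists (g Q); split; split.
  + by exists (\sum_i rtr (Q i)); [exact: sum_rtr_ge0|exact: bc_ee_mac].
  + by move=> _ [P P0 <-]; exact: bc_ee_le_mac.
  + by exists Q.
  + by move=> _ [Q' pQ' <-]; exact: Qge.
- move=> Q Qmax; have [pQ _] := Qmax; split; first exact: sum_rtr_ge0.
  by move=> P P0; rewrite /EE bc_ee_mac//; exact: bc_ee_le_mac.
Qed.
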